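(* Let $\mu_0\in\mathcal M$, let $(\mu_n)_{n\in\mathbb N}$ be a sequence in $\mathcal M$ with $\mathrm{w}^*\text{-}\lim\mu_n=\mu_0$, and suppose $\mu_n\ge c_n\mu_0$, $n\in\mathbb N$, for a sequence $(c_n)$ of positive real numbers with $\liminf_{n\to\infty} c_n\ge1$. Then: (1) $\lim_{n\to\infty}d_p(\mu_n;S)=d_p(\mu_0;S)$ for all non-empty $S\subseteq G\setminus\{0\}$ and all $p\in(0,\infty)$. (2) If, additionally, for given $S$ and $p\in(0,\infty)$ one has $\mu_0\ll\mu_n$ and the metric projection $\phi_{\mu_n,p}(S)$ exists for all $n\in\mathbb N$, then $\lim_{n\to\infty}d_p(\mu_n,\mu_0;S)=d_p(\mu_0;S)$. (3) If, in addition to the assumptions of (2), $\phi_{\mu_0,p}(S)$ exists and $p\in(1,\infty)$, then $\lim_{n\to\infty}\int|\phi_{\mu_0,p}(S)-\phi_{\mu_n,p}(S)|^p\,d\mu_0=0$.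
   Context: $G$ is a locally compact abelian Hausdorff group (written additively), $\Gamma$ is its dual group, and for $x\in G$, $e_x:\Gamma\to\mathbb C$ denotes the character of $\Gamma$ generated by $x$. $\mathcal M$ is the set of all non-zero finite non-negative regular Borel measures on $\Gamma$; inequalities between measures are setwise. For a non-empty set $S\subseteq G\setminus\{0\}$, $\mathcal T(S)$ is the complex linear space of all finite sums $\sum_j a_je_{x_j}$ with $a_j\in\mathbb C$, $x_j\in S$. For $\mu\in\mathcal M$ and $p\in(0,\infty)$, $d_p(\mu;S):=\inf\{\int|1-\tau|^p\,d\mu:\tau\in\mathcal T(S)\}$, and $[\mathcal T(S)]_{\mu,p}$ is the closure of $\mathcal T(S)$ in $L^p(\mu)$. If there is a unique element $\phi_{\mu,p}(S)\in[\mathcal T(S)]_{\mu,p}$ with $d_p(\mu;S)=\int|1-\phi_{\mu,p}(S)|^p\,d\mu$, it is called the metric projection of $1$ onto $[\mathcal T(S)]_{\mu,p}$ and one says that $\phi_{\mu,p}(S)$ exists (it always exists for $p\in(1,\infty)$). If $\mu\ll\nu$ and $\phi_{\nu,p}(S)$ exists, $d_p(\nu,\mu;S):=\int|1-\phi_{\nu,p}(S)|^p\,d\mu\in[0,\infty]$. $\mathrm{w}^*\text{-}\lim\mu_n=\mu_0$ means $\lim_{n}\int f\,d\mu_n=\int f\,d\mu_0$ for every bounded continuous $f:\Gamma\to\mathbb C$. *)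

(* Defs.v *)
From HB Require Import structures.
From mathcomp Require Import all_boot all_order all_algebra.
From mathcomp Require Import all_classical all_reals all_analysis.
From mathcomp Require Import measurable_realfun.
From mathcomp Require Import complex.

Set Implicit Arguments.
Unset Strict Implicit.
Unset Printing Implicit Defensive.

Import Order.TTheory GRing.Theory Num.Theory.
Import numFieldNormedType.Exports.
Import ComplexField.Normc.

Local Open Scope classical_set_scope.
Local Open Scope ring_scope.

(* [R[i]^o] is [R[i]] with its norm topology, and [normc z : R] is the modulus
   of [z : R[i]] (the generic [`|z|] is [R[i]]-valued). *)

(* Characters are continuous homomorphisms into the unit circle of [R[i]]; the
   topology of the dual group is the compact-open one. Only this topology and
   the evaluations [ev x] are used below, so the pointwise product of characters
   is not packaged. *)
Section Dual.
Context (R : realType) (G : topologicalZmodType).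

Definition characters : set {compact-open, G -> R[i]^o} :=
  [set chi | [/\ continuous (chi : G -> R[i]^o),
                 forall x, normc (chi x : R[i]) = 1 &
                 forall x y, chi (x + y) = chi x * chi y]].

Definition dual : Type := set_type characters.
HB.instance Definition _ := Topological.copy dual (set_type characters).

Lemma trivial_character : characters (fun=> 1).
Proof.
split=> [|x|x y]; [exact: cst_continuous|exact: normc1|by rewrite mulr1].
Qed.

HB.instance Definition _ :=
  isPointed.Build dual (exist _ (fun=> 1) (mem_set trivial_character)).

Definition ev (x : G) (g : dual) : R[i] := (\val g : G -> R[i]) x.

Definition dualB := g_sigma_algebraType (@open dual).

End Dual.

Section MetricProjection.
Context (R : realType) (G : topologicalZmodType).
Notation Gamma := (dualB R G).
Implicit Types (mu nu : {finite_measure set Gamma -> \bar R}).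
Implicit Types (S : set G) (p : R) (phi psi tau : Gamma -> R[i]).

Definition regular_measure mu : Prop :=
  forall A : set Gamma, measurable A ->
    mu A = ereal_inf [set mu U | U in [set U : set Gamma |
                                       open (U : set (dual R G)) /\ A `<=` U]]
    /\
    mu A = ereal_sup [set mu K | K in [set K : set Gamma |
                                       compact (K : set (dual R G)) /\ K `<=` A]].

(* The class of non-zero finite non-negative regular Borel measures: finiteness
   and non-negativity are part of the type. *)
Definition regM : set {finite_measure set Gamma -> \bar R} :=
  [set mu | regular_measure mu /\ mu setT != 0%E].

Definition trig S : set (Gamma -> R[i]) :=
  [set tau | exists (n : nat) (a : 'I_n -> R[i]) (x : 'I_n -> G),
     (forall j, S (x j)) /\ tau = fun g => \sum_(j < n) a j * ev (x j) g].

Definition int_pow_dist mu p phi psi : \bar R :=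
  (\int[mu]_g ((normc (phi g - psi g)) `^ p)%:E)%E.

Definition cmeasurable phi : Prop :=
  measurable_fun setT (fun g => complex.Re (phi g)) /\
  measurable_fun setT (fun g => complex.Im (phi g)).

(* Elements of L^p(mu), 0 < p < oo, are represented by functions; equality in
   L^p(mu) is equality mu-almost everywhere. *)
Definition inLp mu p phi : Prop :=
  cmeasurable phi /\ (int_pow_dist mu p phi (fun=> 0%R) < +oo)%E.

(* For all p in ]0, +oo[ the topology of L^p(mu) is the one whose convergence
   phi_n --> phi is \int |phi - phi_n|^p --> 0. *)
Definition trig_closure mu p S : set (Gamma -> R[i]) :=
  [set phi | inLp mu p phi /\
     forall e : R, 0 < e ->
       exists2 tau, trig S tau & (int_pow_dist mu p phi tau < e%:E)%E].

Definition dp mu p S : \bar R :=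
  ereal_inf [set int_pow_dist mu p (fun=> 1%R) tau | tau in trig S].

Definition is_metric_projection mu p S phi : Prop :=
  [/\ trig_closure mu p S phi,
      int_pow_dist mu p (fun=> 1%R) phi = dp mu p S &
      forall psi, trig_closure mu p S psi ->
        int_pow_dist mu p (fun=> 1%R) psi = dp mu p S ->
        {ae mu, forall g, psi g = phi g}].

Definition metric_projection_exists mu p S : Prop :=
  exists phi, is_metric_projection mu p S phi.

(* A representative of the metric projection, when the latter exists. *)
Definition metric_projection mu p S : Gamma -> R[i] :=
  xget (fun=> 0%R) (is_metric_projection mu p S).

Definition dp2 nu mu p S : \bar R :=
  int_pow_dist mu p (fun=> 1%R) (metric_projection nu p S).

Lemma metric_projectionP mu p S : metric_projection_exists mu p S ->
  is_metric_projection mu p S (metric_projection mu p S).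
Proof. by case=> phi phiP; apply: (xgetPex _ (ex_intro _ phi phiP)). Qed.

Lemma cmeasurableB phi psi : cmeasurable phi -> cmeasurable psi ->
  cmeasurable (fun g => phi g - psi g).
Proof.
move=> [mr mi] [nr ni]; split.
- rewrite (_ : (fun g => _) = (fun g => complex.Re (phi g)) \-
    (fun g => complex.Re (psi g))); first exact: measurable_funB.
  by apply/funext => g /=; case: (phi g) => ? ?; case: (psi g).
- rewrite (_ : (fun g => _) = (fun g => complex.Im (phi g)) \-
    (fun g => complex.Im (psi g))); first exact: measurable_funB.
  by apply/funext => g /=; case: (phi g) => ? ?; case: (psi g).
Qed.

Lemma measurable_normc_powR p phi : cmeasurable phi ->
  measurable_fun setT (fun g => (normc (phi g)) `^ p).
Proof.
move=> [mr mi]; apply: (measurableT_comp (measurable_powR p)).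
rewrite (_ : (fun g => _) = Num.sqrt \o
  ((fun g => (complex.Re (phi g)) ^+ 2) \+ (fun g => (complex.Im (phi g)) ^+ 2))).
  apply: measurableT_comp.
    by apply: continuous_measurable_fun; exact: sqrt_continuous.
  by apply: measurable_funD; exact: measurable_funX.
by apply/funext => g /=; case: (phi g).
Qed.

(* Neither [dp2 nu mu p S] nor the distances [int_pow_dist mu p psi _] to the metric
   projection depend on the chosen representative. *)
Lemma int_pow_dist_metric_projection nu mu p S phi psi : mu `<< nu ->
  cmeasurable psi -> is_metric_projection nu p S phi ->
  int_pow_dist mu p psi (metric_projection nu p S) = int_pow_dist mu p psi phi.
Proof.
move=> munu mpsi phiP.
have [c1 d1 _] := metric_projectionP (ex_intro _ phi phiP).
have [[[m1 _] _] [[[m2 _] _] _ u2]] := (c1, phiP).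
have [N [mN N0 sN]] := u2 _ c1 d1.
apply: ge0_ae_eq_integral => //.
- by apply/measurable_EFinP; apply: measurable_normc_powR; exact: cmeasurableB.
- by apply/measurable_EFinP; apply: measurable_normc_powR; exact: cmeasurableB.
- by move=> g _; rewrite lee_fin powR_ge0.
- by move=> g _; rewrite lee_fin powR_ge0.
exists N; split => //.
  by move/null_content_dominatesP : munu; apply.
by move=> g /= h; apply: sN => /= e; apply: h => _; rewrite e.
Qed.

Definition cintegral mu (f : Gamma -> R[i]) : R[i] :=
  Complex (\int[mu]_g complex.Re (f g))%R (\int[mu]_g complex.Im (f g))%R.

Definition wstar_lim (mu_ : nat -> {finite_measure set Gamma -> \bar R}) mu0 :=
  forall f : dual R G -> R[i]^o, continuous f ->
    (exists M : R, forall g, normc (f g : R[i]) <= M) ->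
    (fun n => cintegral (mu_ n) f : R[i]^o) @ \oo --> (cintegral mu0 f : R[i]^o).

End MetricProjection.

(* Main.v *)
Require Import Defs.
From HB Require Import structures.
From mathcomp Require Import all_boot all_order all_algebra.
From mathcomp Require Import all_classical all_reals all_analysis.
From mathcomp Require Import measurable_realfun complex ring lra.
Import Order.TTheory GRing.Theory Num.Theory.
Import numFieldNormedType.Exports.
Import ComplexField.Normc.
Local Open Scope classical_set_scope.
Local Open Scope ring_scope.

(** For a trigonometric polynomial [tau], [|1 - tau|^p] is bounded and
    continuous on the dual group, so its integrals converge
    ([wstar_lim_int_pow_dist]). The infimum over [tau] is therefore upper
    semicontinuous: eventually [dp (mu_ n) p S <= dp mu0 p S + e]
    ([near_dp_le]). In the other direction, the inequality
    [c n * mu0 <= mu_ n] passes to integrals of nonnegative functions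
    ([int_pow_dist_scale_le]), hence to the infima: [c n * dp mu0 p S] is at most
    [dp (mu_ n) p S]. Since the lower limit of [c] is at least [1], the factor
    [c n] costs only an arbitrarily small additive error
    ([near_le_of_scale_le]); this is the first claim.

    Let [phi_n] be the metric projection for [mu_ n]. The same inequality between
    the measures shows that [phi_n] lies in the closure for [mu0]
    ([trig_closure_scale]) and that [c n] times its [mu0]-distance to [1] is at
    most [dp (mu_ n) p S]. The former bounds the [mu0]-distance below by
    [dp mu0 p S] ([dp_le_closure]), the latter, with the upper semicontinuity,
    bounds it above by [dp mu0 p S + e] eventually; this is the
    second claim.

    For the third claim, the second one says that [phi_n] is a minimizing
    sequence for the distance from [1] to a convex set in [L^p(mu0)], [p > 1],
    and so is the constant sequence of the metric projection for [mu0]. By uniform convexity the two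
    approach each other ([near_minimizer_close]). Uniform convexity is
    obtained by integrating a pointwise inequality
    [|u - v|^p <= e (|u|^p + |v|^p) + C ((|u|^p + |v|^p) / 2 - |(u + v) / 2|^p)],
    valid for all [e > 0] with [C] depending on [e] and [p] only. By the
    parallelogram law it concerns four real numbers ([powR_gap]), and it follows
    from a Bernoulli inequality with a quadratic gain
    ([powR_bernoulli_sqr]). *)

Set Implicit Arguments.
Unset Strict Implicit.
Unset Printing Implicit Defensive.

(** * Power inequalities for real numbers *)

(** Young's inequality [y * 1 <= y^p / p + 1 / q], multiplied by [p]. *)
Lemma powR_bernoulli (R : realType) (p y : R) : 1 < p -> 0 <= y ->
  1 + p * (y - 1) <= y `^ p.
Proof.
move=> p1 y0; have p0 : 0 < p by lra.
have q0 : 0 < 1 - p^-1 by rewrite subr_gt0 invf_lt1.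
have := @conjugate_powR R y 1 p (1 - p^-1)^-1 y0 ler01 p0.
rewrite invr_gt0 invrK mulr1 powR1 mul1r => /(_ q0 (subrKC _ _)).
rewrite -(ler_pM2l p0) mulrDr mulrBr mulr1 divff ?gt_eqF// mulrCA mulfV ?gt_eqF//.
lra.
Qed.

(** The quadratic gain comes from writing [(1 + x)^p] as the square of
    [(1 + z)^p] with [1 + z] the square root of [1 + x]: the square of
    Bernoulli's lower bound [1 + p z] exceeds [1 + p x] by [p (p - 1) z^2]. *)
Lemma powR_bernoulli_sqr (R : realType) (p x : R) : 1 < p -> 0 <= x <= 1 ->
  1 + p * x + p * (p - 1) / 9 * x ^+ 2 <= (1 + x) `^ p.
Proof.
move=> p1 /andP[x0 x1]; set z := Num.sqrt (1 + x) - 1.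
have x1z : 1 + x = (1 + z) ^+ 2 by rewrite subrKC sqr_sqrtr//; lra.
have z3 : x / 3 <= z.
  rewrite lerBrDl -(@ler_pXn2r _ 2)// ?nnegrE ?sqrtr_ge0 ?sqr_sqrtr; try lra; try nra.
have z0 : 0 <= z by lra.
have -> : (1 + x) `^ p = ((1 + z) `^ p) ^+ 2.
  by rewrite x1z !expr2 powRM; lra.
have pz : 0 <= p * z by apply: mulr_ge0; lra.
have := @powR_bernoulli R p (1 + z) p1 ltac:(lra).
rewrite addrAC subrr add0r => b; apply: (@le_trans _ _ ((1 + p * z) ^+ 2)).
  have h : x ^+ 2 <= 9 * z ^+ 2 by nra.
  have h' : p * (p - 1) * x ^+ 2 <= p * (p - 1) * (9 * z ^+ 2).
    by apply: ler_wpM2l h; apply: mulr_ge0; lra.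
  have xE : x = 2 * z + z ^+ 2 by lra.
  by rewrite {1}xE; nra.
by apply: lerXn2r => //; rewrite nnegrE ?powR_ge0; lra.
Qed.

(** Quantitative strict convexity of [t ^ p] around [1]. Bernoulli's inequality
    is used with its quadratic gain on the side where the base exceeds [1] only;
    the linear terms of the two sides cancel. *)
Lemma powR_mean_gap (R : realType) (p x : R) : 1 < p -> -1 <= x <= 1 ->
  1 + p * (p - 1) / 18 * x ^+ 2 <= ((1 + x) `^ p + (1 - x) `^ p) / 2.
Proof.
move=> p1; wlog x0 : x / 0 <= x => [wl|] /andP[xN1 x1].
  have [x0|x0] := leP 0 x; first by apply: wl; rewrite // xN1.
  by have := wl (- x); rewrite sqrrN opprK; lra.
have := @powR_bernoulli_sqr R p x p1; rewrite x0 x1 => /(_ isT).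
have := @powR_bernoulli R p (1 - x) p1 ltac:(lra).
lra.
Qed.

(** The case [(s + t) / 2 = 1] of [powR_gap], with [s = 1 + x] and [t = 1 - x].
    By the constraint, [w^2] is the sum of [x^2] and [1 - r^2]; the
    first is controlled by the gap of the scalars [1 + x] and [1 - x], the
    second by [1 - r^p]. So the gap dominates a multiple of [w^2], and [w^p] is
    at most [e] when [w <= e], and at most [1 <= w^2 / e^2] otherwise. *)
Lemma powR_gap1 (R : realType) (p e x r w : R) : 1 < p -> 0 < e ->
  -1 <= x <= 1 -> 0 <= r <= 1 -> 0 <= w <= 1 -> r ^+ 2 + w ^+ 2 = 1 + x ^+ 2 ->
  w `^ p <= e + (Num.min (p * (p - 1) / 18) (1 / 2))^-1 / e ^+ 2 *
     (((1 + x) `^ p + (1 - x) `^ p) / 2 - r `^ p).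
Proof.
move=> p1 e0 x1 /andP[r0 r1] /andP[w0 w1] E.
set c := Num.min _ _.
have c0 : 0 < c by rewrite lt_min; apply/andP; split; [nra|lra].
have cp : c <= p * (p - 1) / 18 by rewrite ge_min lexx.
have c2 : c <= 1 / 2 by rewrite ge_min lexx orbT.
have rp : r `^ p <= r.
  have [->|rn0] := eqVneq r 0; first by rewrite powR0// gt_eqF//; lra.
  by apply: ge1r_powR; rewrite ?(ltW p1)// lt_neqAle eq_sym rn0 r0.
have wp : w `^ p <= w.
  have [->|wn0] := eqVneq w 0; first by rewrite powR0// gt_eqF//; lra.
  by apply: ge1r_powR; rewrite ?(ltW p1)// lt_neqAle eq_sym wn0 w0.
have g := powR_mean_gap p1 x1.
have h : c * w ^+ 2 <= ((1 + x) `^ p + (1 - x) `^ p) / 2 - r `^ p.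
  have -> : w ^+ 2 = x ^+ 2 + (1 - r ^+ 2) by lra.
  have : c * x ^+ 2 <= p * (p - 1) / 18 * x ^+ 2 by rewrite ler_wpM2r ?sqr_ge0.
  have : c * (1 - r ^+ 2) <= 1 / 2 * (1 - r ^+ 2) by apply: ler_wpM2r => //; nra.
  nra.
have {h}h : w ^+ 2 / e ^+ 2 <= c^-1 / e ^+ 2 *
    (((1 + x) `^ p + (1 - x) `^ p) / 2 - r `^ p).
  rewrite [leRHS]mulrAC ler_pM2r ?invr_gt0 ?exprn_gt0//.
  by rewrite ler_pdivlMl.
have [we|ew] := leP w e.
  have : 0 <= w ^+ 2 / e ^+ 2 by rewrite divr_ge0// sqr_ge0.
  lra.
have : 1 <= w ^+ 2 / e ^+ 2 by rewrite ler_pdivlMr ?exprn_gt0// mul1r; nra.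
lra.
Qed.

(** Uniform convexity of the modulus for exponents [p > 1], freed of complex
    numbers: [s] and [t] stand for [|u|] and [|v|], [m] for [|u + v| / 2], [w]
    for [|u - v| / 2], and the quadratic constraint is the parallelogram law.
    Both sides are homogeneous of degree [p], which reduces the claim to
    [powR_gap1]. *)
Lemma powR_gap (R : realType) (p e : R) : 1 < p -> 0 < e ->
  exists2 C : R, 0 <= C & forall s t m w : R, 0 <= s -> 0 <= t -> 0 <= m -> 0 <= w ->
    m <= (s + t) / 2 -> w <= (s + t) / 2 ->
    m ^+ 2 + w ^+ 2 = (s ^+ 2 + t ^+ 2) / 2 ->
    (2 * w) `^ p <= e * (s `^ p + t `^ p) + C * ((s `^ p + t `^ p) / 2 - m `^ p).
Proof.
move=> p1 e0; have p0 : p != 0 by rewrite gt_eqF//; lra.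
have P0 : 0 < 2 `^ p :> R by rewrite powR_gt0.
(* [(s^p + t^p) / 2] is at least [((s + t) / 2)^p], so an error [e * 2 / 2^p]
   in the normalized inequality becomes [e * (s^p + t^p)] *)
have f0 : 0 < e * 2 / 2 `^ p by rewrite !mulr_gt0// invr_gt0.
set c := (Num.min (p * (p - 1) / 18) (1 / 2))^-1 / (e * 2 / 2 `^ p) ^+ 2.
have c0 : 0 <= c.
  rewrite mulr_ge0// invr_ge0 ?sqr_ge0// le_min; apply/andP; split; [nra|lra].
exists (2 `^ p * c); first by rewrite mulr_ge0// ltW.
move=> s t m w s0 t0 m0 w0 ma wa E.
set a := (s + t) / 2; have [a0|a0] := leP a 0.
  have -> : s = 0 by rewrite /a in a0; lra.
  have -> : t = 0 by rewrite /a in a0; lra.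
  have -> : m = 0 by rewrite /a in a0; lra.
  have -> : w = 0 by rewrite /a in a0; lra.
  by rewrite mulr0 powR0//; lra.
have an0 : a != 0 by rewrite gt_eqF.
pose x := (s - t) / 2 / a.
have sE : s = a * (1 + x) by rewrite /x mulrDr mulrCA mulfV// /a; lra.
have tE : t = a * (1 - x) by rewrite /x mulrBr mulrCA mulfV// /a; lra.
have x1 : 0 <= 1 + x by rewrite -(pmulr_rge0 _ a0) -sE.
have x2 : 0 <= 1 - x by rewrite -(pmulr_rge0 _ a0) -tE.
have mE : m = a * (m / a) by rewrite mulrCA mulfV// mulr1.
have wE : w = a * (w / a) by rewrite mulrCA mulfV// mulr1.
have r0 : 0 <= m / a by rewrite divr_ge0// ltW.
have v0 : 0 <= w / a by rewrite divr_ge0// ltW.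
have r1 : m / a <= 1 by rewrite ler_pdivrMr// mul1r.
have v1 : w / a <= 1 by rewrite ler_pdivrMr// mul1r.
have F : (m / a) ^+ 2 + (w / a) ^+ 2 = 1 + x ^+ 2.
  apply: (@mulfI _ (a ^+ 2)); first by rewrite expf_neq0.
  by rewrite mulrDr -!exprMn -mE -wE E {1}sE {1}tE; field.
have x11 : -1 <= x <= 1 by apply/andP; lra.
have := powR_gap1 p1 f0 x11 (introT andP (conj r0 r1))
  (introT andP (conj v0 v1)) F.
rewrite -/c => key.
have g : 1 <= ((1 + x) `^ p + (1 - x) `^ p) / 2.
  apply: le_trans (powR_mean_gap p1 x11); rewrite lerDl mulr_ge0 ?sqr_ge0//; nra.
have aM z : 0 <= z -> (a * z) `^ p = a `^ p * z `^ p.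
  by move=> z0; rewrite powRM// ltW.
rewrite [in leLHS]powRM// [in leLHS]wE mE sE tE !aM//.
set A := a `^ p; set s' := (1 + x) `^ p; set t' := (1 - x) `^ p.
rewrite -/s' -/t' in key g.
set W := (w / a) `^ p in key *; set M := (m / a) `^ p in key *.
have A0 : 0 < A by rewrite powR_gt0.
rewrite [leLHS](_ : _ = A * (2 `^ p * W)); last by ring.
rewrite [leRHS](_ : _ = A * (e * (s' + t') + 2 `^ p * (c * ((s' + t') / 2 - M)))); last by field.
rewrite ler_pM2l//; apply: (@le_trans _ _ (2 `^ p * (e * 2 / 2 `^ p + c * ((s' + t') / 2 - M)))).
  by rewrite ler_pM2l.
rewrite mulrDr lerD2r (mulrC (e * 2)) mulVKf ?gt_eqF// ler_pM2l//; lra.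
Qed.

(** A substitute for Minkowski's inequality that holds for all [p > 0], [p < 1]
    included: if [t] is at most a small multiple of [s] then it perturbs the
    power of [s] by a factor close to [1] only, and otherwise [s] is at most a
    large multiple of [t]. *)
Lemma powR_add_le (R : realType) (p e : R) : 0 < p -> 0 < e ->
  exists2 C : R, 0 <= C & forall s t m : R, 0 <= s -> 0 <= t -> 0 <= m -> m <= s + t ->
    m `^ p <= (1 + e) * s `^ p + C * t `^ p.
Proof.
move=> p0 e0; set d := (1 + e) `^ p^-1 - 1.
have d0 : 0 < d.
  have : 1 `^ p^-1 < (1 + e) `^ p^-1.
    by apply: gt0_ltr_powR; rewrite ?invr_gt0// ?nnegrE; lra.
  by rewrite powR1 subr_gt0.
have dE : (1 + d) `^ p = 1 + e.
  by rewrite subrKC -powRrM mulVf ?gt_eqF// powRr1//; lra.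
(* [d] is chosen with [(1 + d)^p = 1 + e]; the two cases are [t <= d s] and
   [d s < t] *)
exists ((1 + d^-1) `^ p); first exact: powR_ge0.
move=> s t m s0 t0 m0 mst; have [h|h] := leP t (d * s).
  rewrite (@le_trans _ _ (((1 + d) * s) `^ p))//; last first.
    rewrite powRM; [|lra|lra]; rewrite dE lerDl mulr_ge0 ?powR_ge0//.
  by apply: ge0_ler_powR; rewrite ?nnegrE; nra.
have di : 0 < d^-1 by rewrite invr_gt0.
have h' : s <= d^-1 * t by rewrite ler_pdivlMl// ltW.
rewrite (@le_trans _ _ (((1 + d^-1) * t) `^ p))//; last first.
  rewrite powRM; [|lra|lra]; rewrite lerDr mulr_ge0 ?powR_ge0//; lra.
by apply: ge0_ler_powR; rewrite ?nnegrE; nra.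
Qed.

(** * The modulus, characters and trigonometric polynomials *)

Section Modulus.
Context (R : realType).
Implicit Types (u v : R[i]).

Lemma normc_ge0 u : 0 <= normc u.
Proof. by case: u => a b; exact: sqrtr_ge0. Qed.

Lemma ler_normcD u v : normc (u + v) <= normc u + normc v.
Proof. exact: (@le_normcD R). Qed.

Lemma normc_opp u : normc (- u) = normc u.
Proof. exact: (@normcN R). Qed.

Lemma normc_sub u v : normc (u - v) = normc (v - u).
Proof. by rewrite -normc_opp opprB. Qed.

Lemma normcX2 u : normc u ^+ 2 = complex.Re u ^+ 2 + complex.Im u ^+ 2.
Proof. by case: u => a b /=; rewrite sqr_sqrtr// addr_ge0 ?sqr_ge0. Qed.

Lemma normcZ (a : R) u : 0 <= a -> normc (a%:C%C * u) = a * normc u.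
Proof. by move=> a0; rewrite normcM /= expr0n addr0 sqrtr_sqr ger0_norm. Qed.

Lemma dist_normc u v : `|normc u - normc v| <= normc (u - v).
Proof.
have h (x y : R[i]) : normc x <= normc (x - y) + normc y.
  by have := ler_normcD (x - y) y; rewrite subrK.
rewrite ler_norml; have := h u v; have := h v u; rewrite normc_sub; lra.
Qed.

Lemma normr_Re_le u : `|complex.Re u| <= normc u.
Proof.
case: u => a b /=; rewrite -sqrtr_sqr; apply: ler_wsqrtr.
by rewrite lerDl sqr_ge0.
Qed.

Lemma normr_Im_le u : `|complex.Im u| <= normc u.
Proof.
case: u => a b /=; rewrite -sqrtr_sqr; apply: ler_wsqrtr.
by rewrite lerDr sqr_ge0.
Qed.

(** In the normed space [R[i]] the norm and the radii are complex; a positive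
    complex number is real, so the real modulus and real radii suffice. *)
Lemma cvg_normcP (T : Type) (F : set_system T) (FF : Filter F) (f : T -> R[i]^o)
   (l : R[i]^o) :
  f @ F --> l <-> forall e : R, 0 < e -> \forall t \near F, normc ((l : R[i]) - f t) < e.
Proof.
split.
  move=> /cvgrPdist_lt h e e0.
  by have := h e%:C%C; rewrite ltcR => /(_ e0); under eq_near do rewrite ltcR.
move=> h; apply/cvgrPdist_lt => -[a b]; rewrite ltcE /= => /andP[/eqP -> a0].
have := h a a0; apply: filterS => t ht.
by rewrite -[X in _ < X]/(a%:C%C) ltcR.
Qed.

End Modulus.

Section Trig.
Context (R : realType) (G : topologicalZmodType).

(** Points are compact, so the compact-open topology refines the pointwise one. *)
Lemma continuous_ev (x : G) : continuous (ev x : dual R G -> R[i]^o).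
Proof.
apply/continuousP => O oO.
exists [set g | g @` [set x] `<=` O].
  by apply: compact_open_open => //; exact: compact_set1.
by rewrite predeqE => g; split=> [h|Og]; [apply: h; exists x|move=> _ [_ -> <-]].
Qed.

Lemma continuous_trig (S : set G) (tau : dualB R G -> R[i]) : trig S tau ->
  continuous (tau : dual R G -> R[i]^o).
Proof.
move=> [n [a [x [_ ->]]]].
apply: (@continuous_big R[i]^o _ +%R 0) => [|j _ g]; first exact: add_continuous.
by apply: (@cvgZl_tmp R[i] R[i]^o); [exact: nbhs_filter|exact: continuous_ev].
Qed.

Lemma continuous_lipschitz (L : R[i] -> R) (f : dual R G -> R[i]^o) :
  (forall u v, `|L u - L v| <= normc (u - v)) ->
  continuous f -> continuous (L \o f).
Proof.
move=> LL cf g; have FF := nbhs_filter g; apply/cvgrPdist_lt => e e0.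
have /(cvg_normcP FF)/(_ e e0) := cf g.
by apply: filterS => t; apply: le_lt_trans; exact: LL.
Qed.

Lemma continuous_measurable_dual (f : dual R G -> R) : continuous f ->
  measurable_fun setT (f : dualB R G -> R).
Proof.
move=> /continuousP cf; apply: (measurability _ (RGenOpens.measurableE R)).
move=> _ [_ [a [b ->] <-]]; rewrite setTI; apply: sub_sigma_algebra.
exact/cf/interval_open.
Qed.

Lemma trig_cmeasurable (S : set G) (tau : dualB R G -> R[i]) : trig S tau ->
  cmeasurable tau.
Proof.
move=> /continuous_trig c; split; apply: continuous_measurable_dual.
  apply: (continuous_lipschitz (L := @complex.Re R)) c => -[a b] [a' b'].
  exact: (@normr_Re_le R (Complex (a - a') (b - b'))).
apply: (continuous_lipschitz (L := @complex.Im R)) c => -[a b] [a' b'].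
exact: (@normr_Im_le R (Complex (a - a') (b - b'))).
Qed.

Lemma trig_bounded (S : set G) (tau : dualB R G -> R[i]) : trig S tau ->
  exists M, forall g, normc (tau g) <= M.
Proof.
move=> [n [a [x [_ ->]]]]; exists (\sum_(j < n) normc (a j)) => g.
elim/big_ind2 : _ => [|u u' v v' uu vv|j _]; first by rewrite normc0.
  by apply: le_trans (ler_normcD _ _) _; exact: lerD.
have [_ unit _] := set_mem (valP g).
by rewrite normcM /ev unit mulr1.
Qed.

Definition midpoint (phi psi : dualB R G -> R[i]) : dualB R G -> R[i] :=
  fun g => 2^-1%:C%C * (phi g + psi g).

Lemma trig_midpoint (S : set G) (tau tau' : dualB R G -> R[i]) :
  trig S tau -> trig S tau' -> trig S (midpoint tau tau').
Proof.
move=> [n [a [x [Sx ->]]]] [m [b [y [Sy ->]]]].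
exists (n + m)%N, (fun j : 'I_(n + m) => 2^-1%:C%C * match fintype.split j with inl i => a i | inr i => b i end),
  (fun j : 'I_(n + m) => match fintype.split j with inl i => x i | inr i => y i end).
split=> [j|]; first by case: fintype.split.
apply/funext => g; rewrite /midpoint big_split_ord /= mulrDr !mulr_sumr; congr (_ + _).
  by apply: eq_bigr => i _; rewrite mulrA (unsplitK (inl i)).
by apply: eq_bigr => i _; rewrite mulrA (unsplitK (inr i)).
Qed.

Lemma trig0 (S : set G) : trig S (fun=> 0 : R[i]).
Proof.
exists 0%N, (fun=> 0), (fun=> 0); split=> [[]//|].
by apply/funext => g; rewrite big_ord0.
Qed.

End Trig.

(** * Integrals of powers of distances *)

(** The term with [f3] stands on the left because a subtraction of integrals
    would need them to be finite. *)
Lemma ge0_integral_add_le d (T : measurableType d) (R : realType)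
    (mu : {measure set T -> \bar R}) (f0 f1 f2 f3 : T -> R) (a b c : R) :
  measurable_fun setT f0 -> measurable_fun setT f1 ->
  measurable_fun setT f2 -> measurable_fun setT f3 ->
  (forall x, 0 <= f0 x) -> (forall x, 0 <= f1 x) ->
  (forall x, 0 <= f2 x) -> (forall x, 0 <= f3 x) ->
  0 <= a -> 0 <= b -> 0 <= c ->
  (forall x, f0 x + c * f3 x <= a * f1 x + b * f2 x) ->
  (\int[mu]_x (f0 x)%:E + c%:E * \int[mu]_x (f3 x)%:E <=
     a%:E * \int[mu]_x (f1 x)%:E + b%:E * \int[mu]_x (f2 x)%:E)%E.
Proof.
move=> /measurable_EFinP m0 /measurable_EFinP m1 /measurable_EFinP m2.
move=> /measurable_EFinP m3 p0 p1 p2 p3 a0 b0 c0 le.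
have mZ (k : R) (f : T -> R) : measurable_fun setT (EFin \o f) ->
    measurable_fun setT (fun x => (k%:E * (f x)%:E)%E).
  by move=> mf; exact: measurable_funeM.
have pZ (k : R) (f : T -> R) : 0 <= k -> (forall x, 0 <= f x) ->
    forall x, setT x -> (0 <= k%:E * (f x)%:E)%E.
  by move=> k0 f0' x _; rewrite -EFinM lee_fin mulr_ge0.
have intZ (k : R) (f : T -> R) : 0 <= k -> (forall x, 0 <= f x) ->
    measurable_fun setT (EFin \o f) ->
    (k%:E * \int[mu]_x (f x)%:E = \int[mu]_x (k%:E * (f x)%:E))%E.
  by move=> k0 f0' mf; rewrite ge0_integralZl_EFin// => x _; rewrite lee_fin.
have pE (f : T -> R) : (forall x, 0 <= f x) ->
    forall x, setT x -> (0 <= (f x)%:E)%E by move=> h x _; rewrite lee_fin.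
rewrite !intZ//.
rewrite -(ge0_integralD _ measurableT (pE _ p0) m0 (pZ _ _ c0 p3) (mZ _ _ m3)).
rewrite -(ge0_integralD _ measurableT (pZ _ _ a0 p1) (mZ _ _ m1)
  (pZ _ _ b0 p2) (mZ _ _ m2)).
apply: ge0_le_integral => //.
- by move=> x _; rewrite -EFinM -EFinD lee_fin addr_ge0 ?mulr_ge0.
- by apply: emeasurable_funD; [|exact: mZ].
- by apply: emeasurable_funD; exact: mZ.
- by move=> x _; rewrite -!EFinM -!EFinD lee_fin.
Qed.

Section Integral.
Context (R : realType) (G : topologicalZmodType).
Notation Gamma := (dualB R G).
Implicit Types (mu nu : {finite_measure set Gamma -> \bar R}).
Implicit Types (S : set G) (p : R) (phi psi tau : Gamma -> R[i]).

Lemma cmeasurable_cst (z : R[i]) : cmeasurable ((fun=> z) : Gamma -> R[i]).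
Proof. by split; exact: measurable_cst. Qed.

Lemma cmeasurable_midpoint phi psi : cmeasurable phi -> cmeasurable psi ->
  cmeasurable (midpoint phi psi).
Proof.
move=> [rphi iphi] [rpsi ipsi]; split.
  rewrite (_ : (fun g => _) =
      (fun g => 2^-1 * (complex.Re (phi g) + complex.Re (psi g)))).
    by apply: measurable_funM => //; exact: measurable_funD.
  by apply/funext => g; rewrite /midpoint; case: (phi g) (psi g) => ? ? [? ?] /=; rewrite mul0r subr0.
rewrite (_ : (fun g => _) =
    (fun g => 2^-1 * (complex.Im (phi g) + complex.Im (psi g)))).
  by apply: measurable_funM => //; exact: measurable_funD.
by apply/funext => g; rewrite /midpoint; case: (phi g) (psi g) => ? ? [? ?] /=; rewrite mul0r addr0.
Qed.

Lemma measurable_pow_dist p phi psi : cmeasurable phi -> cmeasurable psi ->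
  measurable_fun setT (fun g => (normc (phi g - psi g) `^ p)%:E).
Proof.
move=> mphi mpsi; apply/measurable_EFinP.
by apply: measurable_normc_powR; exact: cmeasurableB.
Qed.

Lemma int_pow_dist_ge0 mu p phi psi : (0 <= int_pow_dist mu p phi psi)%E.
Proof. by apply: integral_ge0 => g _; rewrite lee_fin powR_ge0. Qed.

Lemma int_pow_dist_scale_le mu nu (c p : R) phi psi : 0 <= c ->
  (forall A, measurable A -> (c%:E * mu A <= nu A)%E) ->
  cmeasurable phi -> cmeasurable psi ->
  (c%:E * int_pow_dist mu p phi psi <= int_pow_dist nu p phi psi)%E.
Proof.
move=> c0 cmunu mphi mpsi; pose k := NngNum c0.
have := ge0_integral_mscale mu measurableT k (measurable_pow_dist p mphi mpsi).
move=> <-; last by move=> g _; rewrite lee_fin powR_ge0.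
apply: ge0_le_measure_integral => //; last exact: measurable_pow_dist.
by move=> g; rewrite lee_fin powR_ge0.
Qed.

Lemma int_pow_dist_add_le mu p (a b c : R)
    phi0 psi0 phi1 psi1 phi2 psi2 phi3 psi3 :
  cmeasurable phi0 -> cmeasurable psi0 -> cmeasurable phi1 ->
  cmeasurable psi1 -> cmeasurable phi2 -> cmeasurable psi2 ->
  cmeasurable phi3 -> cmeasurable psi3 ->
  0 <= a -> 0 <= b -> 0 <= c ->
  (forall g, normc (phi0 g - psi0 g) `^ p + c * normc (phi3 g - psi3 g) `^ p <=
     a * normc (phi1 g - psi1 g) `^ p + b * normc (phi2 g - psi2 g) `^ p) ->
  (int_pow_dist mu p phi0 psi0 + c%:E * int_pow_dist mu p phi3 psi3 <=
     a%:E * int_pow_dist mu p phi1 psi1 + b%:E * int_pow_dist mu p phi2 psi2)%E.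
Proof.
move=> m0 n0 m1 n1 m2 n2 m3 n3 a0 b0 c0 le.
apply: ge0_integral_add_le => //; try (by move=> g; exact: powR_ge0);
  by apply: measurable_normc_powR; exact: cmeasurableB.
Qed.

Lemma int_pow_dist_le_add mu p (a b : R) phi0 psi0 phi1 psi1 phi2 psi2 :
  cmeasurable phi0 -> cmeasurable psi0 -> cmeasurable phi1 ->
  cmeasurable psi1 -> cmeasurable phi2 -> cmeasurable psi2 ->
  0 <= a -> 0 <= b ->
  (forall g, normc (phi0 g - psi0 g) `^ p <=
     a * normc (phi1 g - psi1 g) `^ p + b * normc (phi2 g - psi2 g) `^ p) ->
  (int_pow_dist mu p phi0 psi0 <=
     a%:E * int_pow_dist mu p phi1 psi1 + b%:E * int_pow_dist mu p phi2 psi2)%E.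
Proof.
move=> m0 n0 m1 n1 m2 n2 a0 b0 le.
rewrite -[leLHS]adde0 -[X in (_ + X)%E](mul0e (int_pow_dist mu p phi0 psi0)).
by apply: int_pow_dist_add_le => // g; rewrite mul0r addr0.
Qed.

Lemma dp_ge0 mu p S : (0 <= dp mu p S)%E.
Proof. by apply: le_ereal_inf_tmp => _ [tau _ <-]; exact: int_pow_dist_ge0. Qed.

Lemma dp_le mu p S tau : trig S tau ->
  (dp mu p S <= int_pow_dist mu p (fun=> 1%R) tau)%E.
Proof. by move=> Stau; apply: ereal_inf_lbound; exists tau. Qed.

Lemma int_pow_dist_bounded mu p phi psi (M : R) : 0 <= p ->
  cmeasurable phi -> cmeasurable psi ->
  (forall g, normc (phi g - psi g) <= M) -> int_pow_dist mu p phi psi \is a fin_num.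
Proof.
move=> p0 mphi mpsi bd; rewrite ge0_fin_numE ?int_pow_dist_ge0//.
apply: (@le_lt_trans _ _ (\int[mu]_(g in setT) (M `^ p)%:E)%E).
  apply: ge0_le_integral => //; first by move=> g _; rewrite lee_fin powR_ge0.
    exact: measurable_pow_dist.
  move=> g _; rewrite lee_fin; apply: ge0_ler_powR => //.
    by rewrite nnegrE normc_ge0.
  by rewrite nnegrE; apply: le_trans (bd g); exact: normc_ge0.
rewrite integral_cst// lte_mul_pinfty ?lee_fin ?powR_ge0//.
by rewrite ltey_eq fin_num_measure.
Qed.

Lemma dp_fin_num mu p S : 0 <= p -> dp mu p S \is a fin_num.
Proof.
move=> p0; rewrite ge0_fin_numE ?dp_ge0//.
apply: le_lt_trans (dp_le mu p (@trig0 R G S)) _.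
rewrite ltey_eq; apply/orP; left.
apply: (@int_pow_dist_bounded _ _ _ _ 1) => //; try exact: cmeasurable_cst.
by move=> g; rewrite subr0 normc1.
Qed.

(** Convergence for [nu] implies convergence for the smaller measure [c mu]. *)
Lemma trig_closure_scale mu nu p S (c : R) : 0 < c ->
  (forall A, measurable A -> (c%:E * mu A <= nu A)%E) ->
  trig_closure nu p S `<=` trig_closure mu p S.
Proof.
move=> c0 cmunu phi [[mphi fphi] aphi]; split.
  split => //.
  have := int_pow_dist_scale_le p (ltW c0) cmunu mphi (cmeasurable_cst 0).
  move=> /le_lt_trans/(_ fphi).
  by rewrite -[ltRHS](gt0_mulye (x := c%:E)) ?lte_fin// muleC lte_pmul2r ?lte_fin.
move=> e e0; have [tau Stau ltau] := aphi _ (mulr_gt0 c0 e0); exists tau => //.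
have := int_pow_dist_scale_le p (ltW c0) cmunu mphi (trig_cmeasurable Stau).
by move=> /le_lt_trans/(_ ltau); rewrite EFinM lte_pmul2l// lte_fin.
Qed.

End Integral.

(** * The closure of the trigonometric polynomials *)

(** Bounds a product whose factor [x] may vanish, which rules out the choice
    [a / x] for the other factor. *)
Lemma mulr_frac_le (R : realFieldType) (a x : R) :
  0 <= a -> 0 <= x -> x * (a / (x + 1)) <= a.
Proof.
move=> a0 x0; rewrite mulrCA ler_piMr// ler_pdivrMr ?ltr_wpDl// mul1r.
by rewrite lerDl.
Qed.

Section Closure.
Context (R : realType) (G : topologicalZmodType).
Notation Gamma := (dualB R G).
Implicit Types (mu nu : {finite_measure set Gamma -> \bar R}).
Implicit Types (S : set G) (p : R) (phi psi tau : Gamma -> R[i]).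

(** The distance to an element of the closure is a limit of distances to
    trigonometric polynomials. As [p] may be below [1], this rests on
    [powR_add_le] rather than on the triangle inequality in [L^p]. *)
Lemma dp_le_closure mu p S phi : 0 < p -> trig_closure mu p S phi ->
  (dp mu p S <= int_pow_dist mu p (fun=> 1%R) phi)%E.
Proof.
move=> p0 [[mphi _] aphi]; set d := dp mu p S.
have dfin : d \is a fin_num by apply: dp_fin_num; exact: ltW.
set D := int_pow_dist _ _ _ _.
have D0 : (0 <= D)%E by exact: int_pow_dist_ge0.
have [Dfin|] := boolP (D \is a fin_num); last first.
  by rewrite ge0_fin_numE// -leNgt leye_eq => /eqP ->; rewrite leey.
apply/lee_addgt0Pr => e e0.
have Df0 : 0 <= fine D by exact: fine_ge0.
have e1_gt0 : 0 < e / 2 / (fine D + 1).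
  by rewrite !divr_gt0// ltr_wpDl.
have [K K0 HK] := powR_add_le p0 e1_gt0.
have e2_gt0 : 0 < e / 2 / (K + 1) by rewrite !divr_gt0// ltr_wpDl.
have [tau Stau ltau] := aphi _ e2_gt0.
have mtau := trig_cmeasurable Stau.
apply: le_trans (dp_le mu p Stau) _.
apply: le_trans.
  apply: (@int_pow_dist_le_add _ _ mu p (1 + e / 2 / (fine D + 1)) K _ _ (fun=> 1) phi phi tau) => //;
    try exact: cmeasurable_cst; last first.
  - move=> g; apply: HK; rewrite ?normc_ge0//.
    by rewrite -[X in normc X](subrKA (phi g)); exact: ler_normcD.
  - by rewrite addr_ge0// ltW.
have taufin : int_pow_dist mu p phi tau \is a fin_num.
  by rewrite ge0_fin_numE ?int_pow_dist_ge0// (lt_trans ltau)// ltry.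
rewrite -/D -(fineK Dfin) -(fineK taufin); move: ltau; rewrite -(fineK taufin).
rewrite lte_fin => ltau; rewrite -!EFinM -!EFinD lee_fin mulrDl mul1r -addrA lerD2l.
rewrite [leRHS](splitr e); apply: lerD.
  by rewrite mulrC mulr_frac_le// divr_ge0// ltW.
apply: le_trans (ler_wpM2l K0 (ltW ltau)) _.
by rewrite mulr_frac_le// divr_ge0// ltW.
Qed.

Lemma trig_closure_midpoint mu p S phi psi : 0 < p ->
  trig_closure mu p S phi -> trig_closure mu p S psi ->
  trig_closure mu p S (midpoint phi psi).
Proof.
move=> p0 [[mphi fphi] aphi] [[mpsi fpsi] apsi].
have [K K0 HK] := powR_add_le p0 (@ltr01 R).
have half_le (u v : R[i]) : normc (2^-1%:C%C * (u + v)) <= normc u + normc v.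
  rewrite normcZ ?invr_ge0//; have := ler_normcD u v.
  have := normc_ge0 (u + v); lra.
have avg_le (f1 f2 h1 h2 : Gamma -> R[i]) :
    cmeasurable f1 -> cmeasurable f2 -> cmeasurable h1 -> cmeasurable h2 ->
  (int_pow_dist mu p (midpoint f1 f2)
     (midpoint h1 h2) <=
   (1 + 1)%:E * int_pow_dist mu p f1 h1 + K%:E * int_pow_dist mu p f2 h2)%E.
  move=> mf1 mf2 mh1 mh2; apply: int_pow_dist_le_add => //; try exact: cmeasurable_midpoint.
  move=> g; apply: HK; rewrite ?normc_ge0// -mulrBr opprD addrACA.
  exact: half_le.
split.
  split; first exact: cmeasurable_midpoint.
  rewrite (_ : (fun=> 0) = midpoint (fun=> 0) (fun=> 0)); last first.
    by apply/funext => g; rewrite /midpoint addr0 mulr0.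
  apply: le_lt_trans (avg_le _ _ _ _ _ _ _ _) _ => //; try exact: cmeasurable_cst.
  have lt_pinfty (k : R) (x : \bar R) : 0 <= k -> (x < +oo)%E -> (k%:E * x < +oo)%E.
    by move=> k0 xoo; apply: lte_mul_pinfty; rewrite ?lee_fin.
  by apply: lte_add_pinfty; apply: lt_pinfty.
move=> e e0.
have [tau Stau ltau] := aphi (e / 4) ltac:(lra).
have e2_gt0 : 0 < e / 2 / (K + 1) by rewrite !divr_gt0// ltr_wpDl.
have [tau' Stau' ltau'] := apsi _ e2_gt0.
exists (midpoint tau tau'); first exact: trig_midpoint.
have [mtau mtau'] := (trig_cmeasurable Stau, trig_cmeasurable Stau').
apply: le_lt_trans (avg_le _ _ _ _ _ _ _ _) _ => //.
apply: (@lt_le_trans _ _ ((1 + 1)%:E * (e / 4)%:E + K%:E * (e / 2 / (K + 1))%:E)%E).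
  apply: lte_leD.
  - apply: fin_numM => //; rewrite ge0_fin_numE; last exact: int_pow_dist_ge0.
    by apply: lt_trans ltau' _; exact: ltry.
  - by rewrite lte_pmul2l// lte_fin; lra.
  - by rewrite lee_wpmul2l ?lee_fin// ltW.
rewrite -!EFinM -EFinD lee_fin.
have := @mulr_frac_le _ (e / 2) K (divr_ge0 (ltW e0) (ler0n _ 2)) K0.
lra.
Qed.

(** Uniform convexity of [L^p], [p > 1], in the form needed: near-minimizers of
    the distance to [1] are close to each other. Their midpoint also lies in the
    closure, so its distance to [1] is at least [dp mu p S]; the mean of the two
    distances exceeds that of the midpoint by little, and [powR_gap]
    turns this small gap into a small distance between the two. *)
Lemma near_minimizer_close mu p S (e : R) : 1 < p -> 0 < e ->
  exists2 h : R, 0 < h & forall phi psi,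
    trig_closure mu p S phi -> trig_closure mu p S psi ->
    (int_pow_dist mu p (fun=> 1%R) phi <= dp mu p S + h%:E)%E ->
    (int_pow_dist mu p (fun=> 1%R) psi <= dp mu p S + h%:E)%E ->
    (int_pow_dist mu p phi psi <= e%:E)%E.
Proof.
move=> p1 e0; have p0 : 0 < p by lra.
have dfin : dp mu p S \is a fin_num by apply: dp_fin_num; exact: ltW.
have d0 : 0 <= fine (dp mu p S) by apply: fine_ge0; exact: dp_ge0.
set d := fine _ in d0.
have e1_gt0 : 0 < e / 4 / (d + 1) by rewrite !divr_gt0// ltr_wpDl.
have [C C0 HC] := powR_gap p1 e1_gt0.
set e1 := e / 4 / (d + 1) in e1_gt0 HC.
have h0 : 0 < e / 2 / (2 * e1 + C + 1) by rewrite !divr_gt0//; lra.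
(* the bound reached below is [2 e1 d + (2 e1 + C) h], two halves of [e] *)
exists (e / 2 / (2 * e1 + C + 1)) => //; set h := _ / (_ + 1) in h0 *.
move=> phi psi cphi cpsi; rewrite -(fineK dfin) -/d.
have [[[mphi _] _] [[mpsi _] _]] := (cphi, cpsi).
set D1 := int_pow_dist _ _ _ phi; set D2 := int_pow_dist _ _ _ psi => D1h D2h.
have cm := trig_closure_midpoint p0 cphi cpsi.
have := dp_le_closure p0 cm; rewrite -(fineK dfin) -/d.
set m := midpoint phi psi; set M := int_pow_dist _ _ _ m => dM.
have mm : cmeasurable m by exact: cmeasurable_midpoint.
have key : (int_pow_dist mu p phi psi + C%:E * M <=
    (e1 + C / 2)%:E * D1 + (e1 + C / 2)%:E * D2)%E.
  have m1 := @cmeasurable_cst R G 1.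
  have c0 : 0 <= e1 + C / 2 by apply: addr_ge0; [exact: ltW|exact: divr_ge0].
  apply: int_pow_dist_add_le => // g.
  pose w := 2^-1 * normc (phi g - psi g).
  have := HC (normc (1 - phi g)) (normc (1 - psi g)) (normc (1 - m g)) w.
  rewrite /w mulrA divff// mul1r !normc_ge0 mulr_ge0 ?invr_ge0 ?normc_ge0//.
  move=> /(_ isT isT isT isT) H; suff : normc (phi g - psi g) `^ p <=
    e1 * (normc (1 - phi g) `^ p + normc (1 - psi g) `^ p) +
    C * ((normc (1 - phi g) `^ p + normc (1 - psi g) `^ p) / 2 - normc (1 - m g) `^ p).
    lra.
  apply: H.
  - rewrite /m /midpoint (_ : 1 - _ = 2^-1%:C%C * ((1 - phi g) + (1 - psi g))); last first.
      by rewrite addrACA -opprD mulrBr fmorphV rmorph_nat mulVf ?pnatr_eq0.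
    rewrite normcZ ?invr_ge0// mulrC ler_pM2r ?invr_gt0//; exact: ler_normcD.
  - rewrite mulrC ler_pM2r ?invr_gt0//.
    rewrite (_ : phi g - psi g = (1 - psi g) - (1 - phi g)); last by ring.
    by apply: le_trans (ler_normcD _ _) _; rewrite normc_opp addrC.
  - rewrite exprMn !normcX2 /m /midpoint.
    by case: (phi g) (psi g) => a b [a' b'] /=; field.
(* the midpoint enters through [dM] only: its distance to [1] is replaced by
   the infimum [d] *)
have {key}key : (int_pow_dist mu p phi psi + (C * d)%:E <=
    ((e1 + C / 2) * (d + h) + (e1 + C / 2) * (d + h))%:E)%E.
  apply: (@le_trans _ _ (int_pow_dist mu p phi psi + C%:E * M)%E).
    by apply: leeD2l; rewrite EFinM; apply: lee_wpmul2l; rewrite ?lee_fin.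
  apply: (le_trans key); rewrite [leRHS]EFinD [in leRHS]EFinM.
  have c0 : (0 <= (e1 + C / 2)%:E)%E.
    by rewrite lee_fin; apply: addr_ge0; [exact: ltW|exact: divr_ge0].
  by apply: leeD; apply: (lee_wpmul2l c0); rewrite EFinD; [exact: D1h|exact: D2h].
move: key; rewrite -leeBrDr// -EFinB => /le_trans; apply; rewrite lee_fin.
have a1 : d * e1 <= e / 4 by apply: mulr_frac_le => //; rewrite divr_ge0// ltW.
have b0 : 0 <= 2 * e1 + C by rewrite addr_ge0// mulr_ge0// ltW.
have a2 : (2 * e1 + C) * h <= e / 2.
  by apply: mulr_frac_le => //; rewrite divr_ge0// ltW.
lra.
Qed.
End Closure.

(** * Sequences and weak-star convergence *)

(** [powR ^~ p] is not continuous at [0], being [1] on the negative numbers;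
    the sign condition on [f] is essential. *)
Lemma continuous_powR_comp (R : realType) (T : topologicalType) (f : T -> R) (p : R) :
  0 < p -> continuous f -> (forall t, 0 <= f t) -> continuous (fun t => f t `^ p).
Proof.
move=> p0 cf f0 t; have FF := nbhs_filter t.
have [ft0|ft0] := eqVneq (f t) 0.
  apply/cvgrPdist_lt => e e0.
  have r0 : 0 < e `^ p^-1 by rewrite powR_gt0.
  have /cvgrPdist_lt/(_ _ r0) := cf t; apply: filterS => s.
  rewrite ft0 powR0 ?gt_eqF// !sub0r !normrN !ger0_norm ?powR_ge0// => h.
  have -> : e = (e `^ p^-1) `^ p by rewrite -powRrM mulVf ?gt_eqF// powRr1// ltW.
  by apply: gt0_ltr_powR => //; rewrite nnegrE ?f0 ?powR_ge0.
apply: (@continuous_comp _ _ _ f (@powR R ^~ p)); first exact: cf.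
apply: differentiable_continuous; apply/derivable1_diffP.
by apply: derivable_powR; rewrite in_itv /= andbT lt_neqAle eq_sym ft0 f0.
Qed.

Section Sequences.
Context (R : realType).

Lemma near_liminf_ge1 (c : nat -> R) (e : R) : 0 < e ->
  (1 <= limn_einf (fun n => (c n)%:E))%E -> \forall n \near \oo, 1 < (1 + e) * c n.
Proof.
move=> e0; rewrite limn_einf_lim.
have -> := cvg_lim _ (ereal_nondecreasing_cvgn (nondecreasing_einfs (fun n => (c n)%:E))) => //.
move=> /lt_le_trans h.
have : ((1 + e)^-1%:E < ereal_sup (range (einfs (fun n => (c n)%:E))))%E.
  by apply: h; rewrite lte_fin invf_lt1; lra.
move=> /ereal_sup_gt[_ [N _ <-]] lt; near=> n.
rewrite -ltr_pdivrMl ?mulr1; last by lra.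
rewrite -lte_fin; apply: lt_le_trans lt _; apply: ereal_inf_lbound.
by exists n => //=; near: n; exact: nbhs_infty_ge.
Unshelve. all: by end_near. Qed.

Lemma cvge_near_fin (u : nat -> \bar R) (l : \bar R) : l \is a fin_num ->
  (forall e : R, 0 < e -> \forall n \near \oo, (l <= u n + e%:E)%E) ->
  (forall e : R, 0 < e -> \forall n \near \oo, (u n <= l + e%:E)%E) ->
  u @ \oo --> l.
Proof.
case: l => // l _ lu ul.
have fin n (e : R) : (l%:E <= u n + e%:E)%E -> (u n <= l%:E + e%:E)%E ->
  u n \is a fin_num by case: (u n).
apply/fine_cvgP; split.
  by near=> n; apply: (fin n 1); near: n; [exact: lu|exact: ul].
apply/cvgrPdist_le => e e0; near=> n.
have h1 : (l%:E <= u n + e%:E)%E by near: n; exact: lu.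
have h2 : (u n <= l%:E + e%:E)%E by near: n; exact: ul.
rewrite /=; move: h1 h2 (fin n e h1 h2); case: (u n) => // x.
by rewrite -!EFinD !lee_fin /= => h1 h2 _; rewrite ler_norml; apply/andP; split; lra.
Unshelve. all: by end_near. Qed.

(** The way in which the condition on the lower limit of [c] is used: eventually
    [1 < (1 + e') c n], so [y n <= (1 + e') x n], and the boundedness of [x]
    makes the factor an additive error. *)
Lemma near_le_of_scale_le (c : nat -> R) (x y : nat -> \bar R) (d e : R) :
  (forall n, 0 < c n) -> (1 <= limn_einf (fun n => (c n)%:E))%E ->
  0 <= d -> 0 < e ->
  (forall n, (0 <= x n)%E) -> (forall n, (0 <= y n)%E) ->
  (forall n, ((c n)%:E * y n <= x n)%E) ->
  (\forall n \near \oo, (x n <= d%:E)%E) ->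
  \forall n \near \oo, (y n <= x n + e%:E)%E.
Proof.
move=> c0 c1 d0 e0 x0 y0 cyx xd.
have e1 : 0 < e / (d + 1) by rewrite divr_gt0// ltr_wpDl.
near=> n.
have : (x n <= d%:E)%E by near: n.
have : 1 < (1 + e / (d + 1)) * c n by near: n; exact: near_liminf_ge1.
move: (c0 n) (x0 n) (y0 n) (cyx n); case: (y n) => [b| |//].
  case: (x n) => [a| |//]; last by rewrite leey.
  rewrite -EFinM -EFinD !lee_fin => cn0 a0 b0 cb1 cn1 ad.
  have h : b <= (1 + e / (d + 1)) * a.
    apply: le_trans (ler_wpM2l _ cb1); last by rewrite addr_ge0// ltW.
    by rewrite mulrA ler_peMl// ltW.
  apply: (le_trans h); rewrite mulrDl mul1r lerD2l.
  apply: le_trans (ler_wpM2l (ltW e1) ad) _.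
  by rewrite mulrC mulr_frac_le// ltW.
by move=> cn0 _ _; rewrite gt0_muley ?lte_fin// leye_eq => /eqP -> _; rewrite leye_eq.
Unshelve. all: by end_near. Qed.

End Sequences.

Section WeakStar.
Context (R : realType) (G : topologicalZmodType).
Notation Gamma := (dualB R G).
Implicit Types (mu : {finite_measure set Gamma -> \bar R}).
Implicit Types (S : set G) (p : R) (phi psi tau : Gamma -> R[i]).

Lemma wstar_lim_Rintegral (mu_ : nat -> {finite_measure set Gamma -> \bar R}) mu0
    (f : dual R G -> R) (M : R) :
  wstar_lim mu_ mu0 -> continuous f -> (forall g, `|f g| <= M) ->
  (\int[mu_ n]_g f g)%R @[n --> \oo] --> (\int[mu0]_g f g)%R.
Proof.
move=> lim cf fM.
have normcR (x : R) : normc x%:C%C = `|x|.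
  by rewrite /= expr0n addr0 sqrtr_sqr.
have cF : continuous ((fun g => (f g)%:C%C) : dual R G -> R[i]^o).
  move=> g; have FF := nbhs_filter g; apply/cvg_normcP => e e0.
  have /cvgrPdist_lt/(_ e e0) := cf g; apply: filterS => t.
  by rewrite -rmorphB normcR.
have bF : exists M, forall g, normc ((f g)%:C%C : R[i]) <= M.
  by exists M => g; rewrite normcR.
have /cvg_normcP limF := lim _ cF bF.
apply/cvgrPdist_lt => e e0; have := limF e e0; apply: filterS => n.
apply: le_lt_trans; pose F (g : Gamma) : R[i] := (f g)%:C%C.
exact: (normr_Re_le (cintegral mu0 F - cintegral (mu_ n) F)).
Qed.

Lemma int_pow_distE mu p phi psi :
  int_pow_dist mu p phi psi \is a fin_num ->
  int_pow_dist mu p phi psi = (\int[mu]_g normc (phi g - psi g) `^ p)%R%:E.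
Proof. by move=> h; rewrite /Rintegral fineK. Qed.

(** Characters are continuous of modulus [1], so [|1 - tau|^p] is a bounded
    continuous function, to which weak-star convergence applies. *)
Lemma wstar_lim_int_pow_dist (mu_ : nat -> {finite_measure set Gamma -> \bar R})
    mu0 p S tau : 0 < p -> wstar_lim mu_ mu0 -> trig S tau ->
  int_pow_dist (mu_ n) p (fun=> 1) tau @[n --> \oo] -->
    int_pow_dist mu0 p (fun=> 1) tau.
Proof.
move=> p0 lim Stau; have [M tauM] := trig_bounded Stau.
have dist_le g : normc (1 - tau g) <= 1 + M.
  by apply: le_trans (ler_normcD _ _) _; rewrite normc1 normc_opp lerD2l.
have fin mu : int_pow_dist mu p (fun=> 1) tau \is a fin_num.
  apply: (@int_pow_dist_bounded _ _ _ _ _ _ (1 + M)) => //; first exact: ltW.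
  exact: trig_cmeasurable Stau.
rewrite int_pow_distE//; under eq_cvg do rewrite int_pow_distE//.
apply/fine_cvgP; split; first exact: nearW.
apply: (@wstar_lim_Rintegral _ _ _ ((1 + M) `^ p)) => //.
  apply: continuous_powR_comp => // [|g]; last exact: normc_ge0.
  apply: (continuous_lipschitz (L := fun z => normc (1 - z))); last first.
    exact: continuous_trig Stau.
  move=> u v; apply: le_trans (dist_normc _ _) _.
  by rewrite opprB addrC addrA subrK normc_sub.
move=> g; rewrite ger0_norm ?powR_ge0//; apply: ge0_ler_powR => //.
- exact: ltW.
- by rewrite nnegrE normc_ge0.
- by rewrite nnegrE (le_trans _ (dist_le g)) ?normc_ge0.
Qed.

(** An infimum of functionals continuous in the measure is upper
    semicontinuous. *)
Lemma near_dp_le (mu_ : nat -> {finite_measure set Gamma -> \bar R}) mu0 p S e :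
  0 < p -> 0 < e -> wstar_lim mu_ mu0 ->
  \forall n \near \oo, (dp (mu_ n) p S <= dp mu0 p S + e%:E)%E.
Proof.
move=> p0 e0 lim; have dfin := dp_fin_num mu0 S (ltW p0).
have [_ [tau Stau <-] lttau] := lb_ereal_inf_adherent e0 dfin.
have tau_lt : \forall n \near \oo,
    (int_pow_dist (mu_ n) p (fun=> 1%R) tau < dp mu0 p S + e%:E)%E.
  exact: (wstar_lim_int_pow_dist p0 lim Stau (open_ereal_lt' lttau)).
by apply: filterS tau_lt => n /ltW; apply: le_trans; exact: dp_le.
Qed.

End WeakStar.

Unset Implicit Arguments.

(** * Convergence of distances and metric projections *)

Theorem theorem3p10 (R : realType) (G : topologicalZmodType)
    (lcG : locally_compact [set: G]) (hsG : hausdorff_space G)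
    (mu0 : {finite_measure set (dualB R G) -> \bar R})
    (mu_ : nat -> {finite_measure set (dualB R G) -> \bar R})
    (c : nat -> R)
    (Mmu0 : regM mu0) (Mmu_ : forall n, regM (mu_ n))
    (mu_lim : wstar_lim mu_ mu0)
    (c_gt0 : forall n, 0 < c n)
    (c_liminf : (1 <= limn_einf (fun n => (c n)%:E))%E)
    (mu_ge : forall n (A : set (dualB R G)), measurable A ->
       ((c n)%:E * mu0 A <= mu_ n A)%E) :
  [/\ forall (S : set G) (p : R),
        S !=set0 -> S `<=` ~` [set 0] -> 0 < p ->
        dp (mu_ n) p S @[n --> \oo] --> dp mu0 p S,
      forall (S : set G) (p : R),
        S !=set0 -> S `<=` ~` [set 0] -> 0 < p ->
        (forall n, mu0 `<< mu_ n) ->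
        (forall n, metric_projection_exists (mu_ n) p S) ->
        dp2 (mu_ n) mu0 p S @[n --> \oo] --> dp mu0 p S &
      forall (S : set G) (p : R),
        S !=set0 -> S `<=` ~` [set 0] -> 0 < p ->
        (forall n, mu0 `<< mu_ n) ->
        (forall n, metric_projection_exists (mu_ n) p S) ->
        metric_projection_exists mu0 p S ->
        1 < p ->
        int_pow_dist mu0 p (metric_projection mu0 p S)
          (metric_projection (mu_ n) p S) @[n --> \oo] --> 0%E].
Proof.
have near_bound S (p : R) (y : nat -> \bar R) : 0 < p ->
    (forall n, (0 <= y n)%E) ->
    (forall n, ((c n)%:E * y n <= dp (mu_ n) p S)%E) ->
    forall e : R, 0 < e -> \forall n \near \oo, (y n <= dp (mu_ n) p S + e%:E)%E.
  move=> p0 y0 cy e e0; have dfin := dp_fin_num mu0 S (ltW p0).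
  have d0 : 0 <= fine (dp mu0 p S) by apply: fine_ge0; exact: dp_ge0.
  apply: (near_le_of_scale_le c_gt0 c_liminf (addr_ge0 d0 ler01)) => //.
    by move=> n; exact: dp_ge0.
  by rewrite EFinD fineK//; exact: near_dp_le.
have dp_scale S (p : R) n : 0 < p -> ((c n)%:E * dp mu0 p S <= dp (mu_ n) p S)%E.
  move=> p0; apply: le_ereal_inf_tmp => _ [tau Stau <-].
  apply: (@le_trans _ _ ((c n)%:E * int_pow_dist mu0 p (fun=> 1%R) tau)%E).
    by apply: lee_wpmul2l; [rewrite lee_fin ltW|exact: dp_le].
  apply: int_pow_dist_scale_le => //; first exact: ltW.
  - exact: mu_ge.
  - exact: trig_cmeasurable Stau.
have closure0 S (p : R) n : metric_projection_exists (mu_ n) p S ->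
    trig_closure mu0 p S (metric_projection (mu_ n) p S).
  move=> /metric_projectionP[cphi _ _].
  exact: (trig_closure_scale (c_gt0 n) (mu_ge n)).
have near_dp2 S (p : R) : 0 < p ->
    (forall n, metric_projection_exists (mu_ n) p S) ->
    forall e : R, 0 < e ->
      \forall n \near \oo, (dp2 (mu_ n) mu0 p S <= dp mu0 p S + e%:E)%E.
  move=> p0 ex e e0; have e2 : 0 < e / 2 by rewrite divr_gt0.
  have h : \forall n \near \oo,
      (dp2 (mu_ n) mu0 p S <= dp (mu_ n) p S + (e / 2)%:E)%E.
    apply: near_bound => // n; first exact: int_pow_dist_ge0.
    have [[[mphi _] _] <- _] := metric_projectionP (ex n).
    apply: int_pow_dist_scale_le => //; first exact: ltW.
    - exact: mu_ge.
    near=> n; apply: (@le_trans _ _ (dp (mu_ n) p S + (e / 2)%:E)%E).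
    by near: n.
  rewrite {2}(splitr e) EFinD addeA; apply: leeD2r; near: n; exact: near_dp_le.
split=> S p _ _ p0.
- apply: cvge_near_fin => [|e e0|e e0].
  + by apply: dp_fin_num; exact: ltW.
  + by apply: near_bound => // n; [exact: dp_ge0|exact: dp_scale].
  + exact: near_dp_le.
- move=> _ ex; apply: cvge_near_fin => [|e e0|].
  + by apply: dp_fin_num; exact: ltW.
  + apply: nearW => n; apply: (@le_trans _ _ (dp2 (mu_ n) mu0 p S)).
      by apply: dp_le_closure => //; exact: closure0.
    by apply: leeDl; rewrite lee_fin ltW.
  + exact: near_dp2.
move=> _ ex ex0 p1; apply: cvge_near_fin => // e e0.
  by apply: nearW => n; apply: adde_ge0; rewrite ?int_pow_dist_ge0// lee_fin ltW.
have [h h0 close] := near_minimizer_close mu0 S p1 e0.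
have [cphi dphi _] := metric_projectionP ex0.
have hphi : (int_pow_dist mu0 p (fun=> 1%R) (metric_projection mu0 p S) <=
    dp mu0 p S + h%:E)%E.
  by rewrite dphi; apply: leeDl; rewrite lee_fin; exact: ltW.
have := near_dp2 S p p0 ex h h0; apply: filterS => n hpsi; rewrite add0e.
exact: close cphi (closure0 S p n (ex n)) hphi hpsi.
Unshelve. all: by end_near. Qed.
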